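(* Let $(G,X)$ be a Polish topological dynamical system, where $G$ is locally compact, and let $\mu$ be a $G$-invariant Borel probability measure on $X$. Let $\mathcal{E}$ be the set of ergodic Borel probability measures on $X$, let $\beta: X\to\mathcal{E}$, $x\mapsto\beta_x$, be a decomposition map, and let $\nu$ be the push-forward measure of $\mu$ via $\beta$, i.e. the Borel probability measure on $\mathcal{E}$ given by $\nu(A)=\mu(\beta^{-1}(A))$ for Borel subsets $A$ of $\mathcal{E}$. (1) If $f: X\to[0,\infty]$ is Borel measurable, then the extended function $\lambda\mapsto\int_X f(x)\,\mathrm{d}\lambda(x)$, with values in $[0,\infty]$, is a Borel measurable function on $\mathcal{E}$. Furthermore, the equality $$\int_X f(x)\,\mathrm{d}\mu(x)=\int_{\mathcal{E}}\left(\int_X f(x)\,\mathrm{d}\lambda(x)\right)\mathrm{d}\nu(\lambda)$$ holds in $[0,\infty]$. (2) If $f\in\mathcal{L}^1(X,\mu)$, then the set of $\lambda\in\mathcal{E}$ such that $f\notin\mathcal{L}^1(X,\lambda)$ is a Borel subset of $\mathcal{E}$ that has $\nu$-measure zero. For $\lambda\in\mathcal{E}$, let $I_f(\lambda):=\int_X f(x)\,\mathrm{d}\lambda(x)$ if $f\in\mathcal{L}^1(X,\lambda)$, and let $I_f(\lambda):=0$ if $f\notin\mathcal{L}^1(X,\lambda)$. Then $I_f\in\mathcal{L}^1(\mathcal{E},\nu)$, and $$\int_X f(x)\,\mathrm{d}\mu(x)=\int_{\mathcal{E}} I_f(\lambda)\,\mathrm{d}\nu(\lambda).$$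
   Context: A Polish topological dynamical system is a pair $(G,X)$ where the Polish topological group $G$ acts as homeomorphisms on the Polish space $X$ such that the map $(g,x)\mapsto gx$ from $G\times X$ to $X$ is continuous. A Borel measure $\lambda$ on $X$ is $G$-invariant if $\lambda(gY)=\lambda(Y)$ for all $g\in G$ and all Borel $Y\subseteq X$. A Borel subset $Y$ of $X$ is $\lambda$-essentially $G$-invariant if $\lambda(gY\mathbin{\Delta}Y)=0$ for all $g\in G$. An ergodic Borel probability measure is a $G$-invariant Borel probability measure $\lambda$ on $X$ such that $\lambda(Y)=0$ or $\lambda(Y)=1$ for each $\lambda$-essentially $G$-invariant Borel subset $Y$ of $X$. The set $\mathcal{E}$ of ergodic Borel probability measures carries the weak$^*$-topology induced by the bounded continuous functions $\mathrm{C_b}(X)$ (the coarsest topology making $\lambda\mapsto\int_X h\,\mathrm{d}\lambda$ continuous for every $h\in\mathrm{C_b}(X)$) and the ensuing Borel $\sigma$-algebra. A decomposition map is a Borel measurable map $\beta:X\to\mathcal{E}$, $x\mapsto\beta_x$, such that: (i) $\beta_{gx}=\beta_x$ for all $x\in X$, $g\in G$; (ii) $\lambda(\beta^{-1}(\{\lambda\}))=1$ for all $\lambda\in\mathcal{E}$; (iii) for all $G$-invariant Borel probability measures $\mu'$ on $X$ and all Borel subsets $Y$ of $X$, $\mu'(Y)=\int_X\beta_x(Y)\,\mathrm{d}\mu'(x)$. (Under the stated hypotheses $\mathcal{E}\neq\emptyset$ and a decomposition map exists, by work of Farrell and Varadarajan.) For a measure space $(Z,\lambda)$, $\mathcal{L}^1(Z,\lambda)$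 is the set of measurable (for the given $\sigma$-algebra; here the Borel $\sigma$-algebra, without completion) extended functions $f:Z\to\mathbb{R}\cup\{-\infty,\infty\}$ with $\int_Z|f|\,\mathrm{d}\lambda<\infty$; functions are not identified when equal almost everywhere. *)

(* Defs.v *)
From HB Require Import structures.
From mathcomp Require Import all_boot all_order all_algebra.
From mathcomp Require Import all_classical all_reals all_analysis.
From mathcomp Require Import measurable_realfun.

Set Implicit Arguments.
Unset Strict Implicit.
Unset Printing Implicit Defensive.

Import Order.TTheory GRing.Theory Num.Theory.
Import numFieldNormedType.Exports.

Local Open Scope classical_set_scope.
Local Open Scope ring_scope.

HB.mixin Record isTopologicalGroup G of Group G & Topological G := {
  mulg_continuous : continuous (fun p : G * G => (p.1 * p.2)%g) ;
  invg_continuous : continuous (fun g : G => g^-1%g)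
}.

#[short(type="topologicalGroupType")]
HB.structure Definition TopologicalGroup :=
  {G of Group G & Topological G & isTopologicalGroup G}.

Definition separable (T : topologicalType) :=
  exists2 D : set T, countable D & dense D.

Definition completely_metrizable (R : realType) (T : topologicalType) :=
  exists (M : metricType R) (phi : T -> M) (psi : M -> T),
    [/\ cancel phi psi, cancel psi phi, continuous phi, continuous psi &
        forall F : set_system M, ProperFilter F -> cauchy F ->
          exists p : M, F --> p].

Definition polish (R : realType) (T : topologicalType) :=
  separable T /\ completely_metrizable R T.

(* The action is by homeomorphisms: [act g] is continuous with inverse
   [act g^-1]. *)
Definition polish_system (R : realType) (G : topologicalGroupType)
    (X : topologicalType) (act : G -> X -> X) :=
  [/\ polish R G, polish R X,
      (forall x, act 1%g x = x),
      (forall g h x, act (g * h)%g x = act g (act h x)) &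
      continuous (fun p : G * X => act p.1 p.2)].

Definition borel (T : ptopologicalType) : measurableType (@open T).-sigma :=
  g_sigma_algebraType (@open T).

(* Measurable types carry a default point, on which the sigma-algebra does not
   depend. *)
Definition pointed_at (T : Type) (t : T) : Type := T.

HB.instance Definition _ (T : topologicalType) (t : T) :=
  Topological.on (pointed_at t).
HB.instance Definition _ (T : topologicalType) (t : T) :=
  isPointed.Build (pointed_at t) t.

Section ergodic_measures.
Variables (R : realType) (G : topologicalGroupType) (X : ptopologicalType).
Variable act : G -> X -> X.
Implicit Types (l : probability (borel X) R) (Y : set (borel X)).

Definition invariant_measure l :=
  forall g Y, measurable Y -> l (act g @` Y) = l Y.

Definition essentially_invariant l Y :=
  forall g, l ((act g @` Y) `+` Y) = 0%E.

Definition is_ergodic l :=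
  invariant_measure l /\
  forall Y, measurable Y -> essentially_invariant l Y ->
    l Y = 0%E \/ l Y = 1%E.

(* A library measure is a function on all subsets, with arbitrary values outside
   the sigma-algebra. Fixing these values to be 0 selects exactly one
   representative of each Borel measure, so that equality in [ergodic] is
   equality of Borel measures. *)
Definition ergodic_set : set (probability (borel X) R) :=
  [set l | is_ergodic l /\ forall Y, ~ measurable Y -> l Y = 0%E].

Definition ergodic : Type := set_type ergodic_set.

Definition emeas (l : ergodic) : probability (borel X) R := val l.

Definition bounded_continuous : Type :=
  {h : X -> R | continuous h /\ exists M : R, forall x, `|h x| <= M}.

Definition integral_against (h : bounded_continuous) (l : ergodic) : R :=
  (\int[emeas l]_(x in [set: borel X]) sval h x)%R.

HB.instance Definition _ := Choice.on ergodic.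

(* the coarsest topology making every [integral_against h] continuous *)
HB.instance Definition _ := Topological.copy ergodic
  (sup_topology (fun h : bounded_continuous =>
     Topological.on (initial_topology (integral_against h)))).

Definition borel_ergodic (b : X -> ergodic) :=
  borel (pointed_at (b point)).

Definition decomposition_map (b : X -> ergodic) :=
  [/\ measurable_fun [set: borel X] (b : borel X -> borel_ergodic b),
      (forall g x, b (act g x) = b x),
      (forall l : ergodic, emeas l (b @^-1` [set l]) = 1%E) &
      forall m : probability (borel X) R, invariant_measure m ->
        forall Y, measurable Y ->
          m Y = (\int[m]_(x in [set: borel X]) emeas (b x) Y)%E].

Definition integral_or_zero (f : borel X -> \bar R) (l : ergodic) : \bar R :=
  if (emeas l).-integrable [set: borel X] f
  then (\int[emeas l]_(x in [set: borel X]) f x)%E else 0%E.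

End ergodic_measures.

(* Main.v *)
From HB Require Import structures.
Require Import Defs.
From mathcomp Require Import all_boot all_order all_algebra.
From mathcomp Require Import all_classical all_reals all_analysis.
From mathcomp Require Import measurable_realfun giry.

(** The whole statement comes from two facts.

    The first is that [l |-> l Y] is Borel on the space of ergodic measures for
    every Borel set [Y] ([measurable_emeas]). The topology only makes the
    integrals of bounded continuous functions continuous, so indicators have to
    be reached by limits. As [X] is metrizable, a closed set [C] is
    [{x | u x = 1}] for some continuous [u : X -> ]0, 1]], for nonempty
    [C] the exponential of minus the distance to [C] ([closed_level_set]). The powers
    [u ^ n] decrease to the indicator of [C], so [l C] is the limit of the
    integrals of [u ^ n], each of them continuous in [l]. Closed sets are stable
    under intersection and generate the Borel sigma-algebra, and the sets [Y]
    with [l |-> l Y] measurable form a Dynkin system.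

    The second is that [mu] is a mixture: disintegration along the decomposition
    map [b], pushed forward to [nu], reads [mu Y = \int[nu]_l l Y]. Integrals
    against a mixture are iterated integrals. In the language of the Giry monad
    [mu] is the bind of [nu] with the kernel, which settles nonnegative functions
    ([ge0_integral_mixture]). For an integrable [f] ([integral_mixture]), the
    function [l |-> \int[l] |f|] has finite [nu]-integral. It is therefore
    finite [nu]-almost everywhere, and where it is finite the integral of [f] is
    the difference of the integrals of its positive and negative parts, to which
    the nonnegative case applies. *)

Set Implicit Arguments.
Unset Strict Implicit.
Unset Printing Implicit Defensive.

Import Order.TTheory GRing.Theory Num.Theory.
Import numFieldNormedType.Exports.

Local Open Scope classical_set_scope.
Local Open Scope ring_scope.
Local Open Scope ereal_scope.

(** * Closed sets in metrizable spaces *)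

Lemma edist_inf_eq0 (R : realType) (M : pseudoMetricType R) (C : set M) x :
  closed C -> edist_inf C x = 0 -> C x.
Proof.
move=> cC Cx0; apply: cC => B /nbhs_ballP[_/posnumP[e] eB].
have : edist_inf C x < e%:num%:E by rewrite Cx0 lte_fin.
case/ereal_inf_lt => _ [a Ca <-] /edist_lt_ball xa.
by exists a; split => //; exact: eB.
Qed.

(** The value 1, attained exactly on [C], is the maximum of [u]: this is what
    makes the powers of [u] converge to the indicator of [C]. *)
Lemma closed_level_set_metric (R : realType) (M : metricType R) (C : set M) :
  closed C -> exists2 u : M -> R, continuous u &
    (forall x, 0 < u x <= 1)%R /\ C = [set x | u x = 1%R].
Proof.
move=> cC; have [->|/set0P[a Ca]] := eqVneq C set0.
  (* the distance to the empty set is infinite: take any constant in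
     ]0, 1[ *)
  exists (fun=> 2^-1%R); first by move=> x; exact: cvg_cst.
  split => [x|]; first by rewrite invr_gt0 invf_le1 ?ler1n ltr0n.
  by apply/esym; rewrite -subset0 => x /= /eqP; rewrite invr_eq1 pnatr_eq1.
have dfin x : edist_inf C x \is a fin_num.
  rewrite ge0_fin_numE ?edist_inf_ge0//.
  suff : edist (x, a) < +oo.
    by apply: le_lt_trans; apply: ereal_inf_lbound; exists a.
  rewrite -ge0_fin_numE ?edist_ge0//; apply/edist_finP.
  exists (mdist x a + 1)%R; first by rewrite ltr_wpDl ?mdist_ge0.
  by rewrite ballEmdist /= ltrDl.
exists (fun x => expR (- fine (edist_inf C x))).
  move=> x; apply: continuous_comp; last exact: continuous_expR.
  apply: cvgN; apply: fine_cvg; rewrite fineK//; exact: edist_inf_continuous.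
split=> [x|]; first by rewrite expR_gt0 expR_le1 oppr_le0 fine_ge0 ?edist_inf_ge0.
apply/seteqP; split=> x /=.
  by move=> Cx; rewrite edist_inf0// oppr0 expR0.
rewrite -expR0 => /expR_inj /eqP; rewrite oppr_eq0 => /eqP d0.
by apply: edist_inf_eq0 => //; rewrite -(fineK (dfin x)) d0.
Qed.

(** Continuity and level sets are carried over by a homeomorphism, here the one
    with a metric space. *)
Lemma closed_level_set (R : realType) (X : topologicalType) (C : set X) :
  completely_metrizable R X -> closed C -> exists2 u : X -> R, continuous u &
    (forall x, 0 < u x <= 1)%R /\ C = [set x | u x = 1%R].
Proof.
move=> [M [phi [psi [phiK psiK cphi cpsi _]]]] cC.
have cC' : closed (psi @^-1` C) by exact: preimage_closed.
have [u cu [u01 CE]] := closed_level_set_metric cC'.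
exists (u \o phi).
  by move=> x; apply: continuous_comp; [exact: cphi|exact: cu].
split=> [x|]; first exact: u01.
have CEx y : C (psi y) <-> u y = 1%R.
  by rewrite -[C (psi y)]/((psi @^-1` C) y) CE.
apply/seteqP; split=> x /=; first by move=> Cx; apply/CEx; rewrite phiK.
by move=> /CEx; rewrite phiK.
Qed.

(** * Evaluation of ergodic measures on Borel sets *)

Lemma continuous_borel_measurable (R : realType) (T : ptopologicalType)
    (h : T -> R) :
  continuous h -> measurable_fun [set: borel T] (h : borel T -> R).
Proof.
move=> /continuousP ch; apply: (measurability _ (RGenOpens.measurableE R)).
move=> _ [_ [a [b ->]] <-]; rewrite setTI.
apply: sub_sigma_algebra; apply: ch; exact: interval_open.
Qed.

Section evaluation.
Context (R : realType) (G : topologicalGroupType) (X : ptopologicalType).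
Variables (act : G -> X -> X) (b : X -> ergodic R act).

(** The topology of [ergodic] is the supremum of the initial topologies of these
    functions, so convergence in it implies convergence in each of them. *)
Lemma integral_against_continuous (h : bounded_continuous R X) :
  continuous (integral_against h : ergodic R act -> R).
Proof.
move=> l.
pose Tc (i : bounded_continuous R X) :=
  Topological.on (initial_topology (integral_against i : ergodic R act -> R)).
have /(cvg_sup Tc (F := nbhs l) l) lh : nbhs l --> l by [].
move=> U hU; apply: (lh h).
exact: (@initial_continuous (ergodic R act) R (integral_against h) l U hU).
Qed.

(** A bounded function is integrable for a probability, so that no information
    is lost in the real-valued integral that defines [integral_against]. *)
Lemma integral_againstE (h : bounded_continuous R X) (l : ergodic R act) :
  (integral_against h l)%:E = \int[emeas l]_(x in [set: borel X]) (sval h x)%:E.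
Proof.
rewrite /integral_against /Rintegral fineK//.
case: h => h [ch [K hK]] /=.
have int1 : (emeas l).-integrable [set: borel X] (EFin \o cst K).
  exact: finite_measure_integrable_cst.
apply: (@integrable_fin_num _ (borel X)) => //.
apply: (@le_integrable _ (borel X) _ _ _ _ _ (EFin \o cst K)) => //.
  by apply/measurable_EFinP; exact: continuous_borel_measurable.
by move=> x _; rewrite /= lee_fin (le_trans (hK x))// ler_norm.
Qed.

(** With [C = {u = 1}], dominated convergence along the powers of [u] shows
    [l C] to be a pointwise limit of continuous functions of [l]. *)
Lemma measurable_emeas_closed (C : set X) :
  completely_metrizable R X -> closed C ->
  measurable_fun [set: borel_ergodic b]
    (fun l : borel_ergodic b => emeas l (C : set (borel X))).
Proof.
move=> cmX cC; have [u cu [u01 CE]] := closed_level_set cmX cC.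
have cun n : continuous (fun x => u x ^+ n)%R.
  by move=> x; exact: (continuous_comp (cu x) (@exprn_continuous R n (u x))).
have u0 x n : (0 <= u x ^+ n)%R by rewrite exprn_ge0// ltW//; case/andP: (u01 x).
have u1 x n : (u x ^+ n <= 1)%R.
  by rewrite exprn_ile1//; have /andP[/ltW] := u01 x.
have bun n : exists K : R, forall x, (`|u x ^+ n| <= K)%R.
  by exists 1%R => x; rewrite ger0_norm.
pose h n : bounded_continuous R X := exist _ (fun x => u x ^+ n)%R (conj (cun n) (bun n)).
have mC : measurable (C : set (borel X)).
  rewrite -(setCK C); apply: measurableC; apply: sub_sigma_algebra.
  exact: closed_openC.
have mun n : measurable_fun [set: borel X] (fun x : borel X => (u x ^+ n)%:E).
  by apply/measurable_EFinP; exact: continuous_borel_measurable (cun n).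
have ule1 n x : `|(u x ^+ n)%:E| <= (EFin \o cst 1%R) x.
  by rewrite /= lee_fin ger0_norm.
apply: (emeasurable_fun_cvg (fun n (l : borel_ergodic b) =>
    (integral_against (h n) l)%:E)).
  move=> n; apply/measurable_EFinP.
  apply: (@continuous_borel_measurable R (pointed_at (b point))).
  exact: integral_against_continuous.
move=> l _.
have -> : emeas l (C : set (borel X)) =
    \int[emeas l]_(x in [set: borel X]) (\1_C x)%:E.
  by rewrite integral_indic// setIT.
rewrite (_ : (fun n => _) = (fun n =>
  \int[emeas l]_(x in [set: borel X]) (u x ^+ n)%:E)); last first.
  by apply/funext => n; rewrite integral_againstE.
have [] := @dominated_convergence _ (borel X) R (emeas l) setT measurableT
  (fun n x => (u x ^+ n)%:E) (EFin \o \1_C) (EFin \o cst 1%R) mun => //.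
- exact/measurable_EFinP/measurable_indic.
- apply: aeW => x _; apply: cvg_EFin; first exact: nearW.
  rewrite indicE; have [Cx|/negP nCx] := boolP (x \in C).
    have ux1 : u x = 1%R by move: Cx; rewrite inE CE.
    under eq_cvg do rewrite /= ux1 expr1n.
    exact: cvg_cst.
  apply: cvg_expr; have /andP[ux0 ux1] := u01 x.
  rewrite ger0_norm ?ltW// lt_neqAle ux1 andbT; apply/eqP => ux.
  by apply: nCx; rewrite inE CE.
- exact: finite_measure_integrable_cst.
- by apply: aeW => x n _; exact: ule1.
Qed.

(** Dynkin's pi-lambda argument: all the measures have mass 1, so
    complements are harmless, and countable disjoint unions become series. *)
Lemma measurable_emeas (Y : set (borel X)) :
  completely_metrizable R X -> measurable Y ->
  measurable_fun [set: borel_ergodic b] (fun l : borel_ergodic b => emeas l Y).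
Proof.
move=> cmX mY.
have mclosed : @measurable _ (borel X) = <<s @closed X >>.
  apply/seteqP; split; apply: smallest_sub; try exact: smallest_sigma_algebra.
  - move=> U oU; rewrite -(setCK U); apply: sigma_algebraC.
    by apply: sub_sigma_algebra; exact: open_closedC.
  - move=> U cU; rewrite -(setCK U); apply: sigma_algebraC.
    by apply: sub_sigma_algebra; exact: closed_openC.
pose P (A : set (borel X)) :=
  measurable_fun [set: borel_ergodic b] (fun l : borel_ergodic b => emeas l A).
apply: (@dynkin_induction _ (borel X) (@closed X) P mclosed); rewrite -?mclosed//.
- exact: closedI.
- by apply: measurable_emeas_closed => //; exact: closedT.
- by move=> C cC; exact: measurable_emeas_closed.
- move=> A mA PA; rewrite /P (_ : (fun l => _) =
    (fun l : borel_ergodic b => 1 - emeas l A)); last first.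
    by apply/funext => l; rewrite probability_setC.
  exact: emeasurable_funB.
- move=> F mF tF PF; rewrite /P (_ : (fun l => _) =
    (fun l : borel_ergodic b => \sum_(n <oo) emeas l (F n))); last first.
    apply/funext => l; rewrite measure_bigcup//.
    by apply: eq_eseriesl => n; rewrite in_setT.
  by apply: ge0_emeasurable_sum => // n _; exact: PF.
Qed.

End evaluation.

(** * Integration against a mixture of probabilities *)

Section mixture.
Context d d' (S : measurableType d) (T : measurableType d') (R : realType).
Variables (k : S -> probability T R) (nu : probability S R).
Variable mu : probability T R.
Hypothesis mk : forall Y, measurable Y -> measurable_fun [set: S] (k ^~ Y).
Hypothesis mixE : forall Y, measurable Y -> mu Y = \int[nu]_s k s Y.

(** The kernel [k] is a measurable map to the Giry space, and [mu] agrees on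
    measurable sets with the bind of [nu] and [k]. *)
Lemma ge0_integral_mixture (f : T -> \bar R) :
    measurable_fun [set: T] f -> (forall x, 0 <= f x) ->
  \int[mu]_x f x = \int[nu]_s \int[k s]_x f x.
Proof.
move=> mf f0.
have mg : measurable_fun [set: S] (k : S -> giry T R).
  exact: measurable_giry_codensity.
rewrite -[RHS](giry_int_bind nu mg mf f0).
apply: eq_measure_integral => Y mY _.
transitivity (\int[nu]_s k s Y); first exact: mixE.
apply/esym; exact: (giry_int_map mg nu (measurable_giry_ev mY)).
Qed.

(** Integrability for [k s] amounts to the finiteness of [A s], the integral of
    [`|f|]; thus [N] is where the measurable function [A] is infinite, [If] is
    dominated by [A], and off [N] it is the difference of the integrals [P] and
    [M] of the positive and negative parts. *)
Lemma integral_mixture (f : T -> \bar R) :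
    mu.-integrable [set: T] f ->
  let N := [set s | ~ (k s).-integrable [set: T] f] in
  let If s := if (k s).-integrable [set: T] f then \int[k s]_x f x else 0 in
  [/\ measurable N, nu N = 0, nu.-integrable [set: S] If &
      \int[mu]_x f x = \int[nu]_s If s].
Proof.
move=> intf N If; have mf := measurable_int _ intf.
have mint g : measurable_fun [set: T] g -> (forall x, 0 <= g x) ->
    measurable_fun [set: S] (fun s => \int[k s]_x g x).
  by move=> mg g0; exact: measurable_fun_integral_kernel.
have int_mix g : measurable_fun [set: T] g -> (forall x, 0 <= g x) ->
    \int[mu]_x g x < +oo -> nu.-integrable [set: S] (fun s => \int[k s]_x g x).
  move=> mg g0 goo; apply/integrableP; split; first exact: mint.
  under eq_integral do rewrite gee0_abs ?integral_ge0//.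
  by rewrite -ge0_integral_mixture.
have mabsf : measurable_fun [set: T] (fun x => `|f x|).
  exact: measurableT_comp.
pose A s := \int[k s]_x `|f x|.
have mA : measurable_fun [set: S] A by exact: mint.
have intA : nu.-integrable [set: S] A.
  by apply: int_mix => //; case/integrableP: intf.
pose P s := \int[k s]_x f^\+ x; pose M s := \int[k s]_x f^\- x.
have intP : nu.-integrable [set: S] P.
  apply: int_mix => //; first exact: measurable_funepos.
  exact: integral_funepos_lt_pinfty.
have intM : nu.-integrable [set: S] M.
  apply: int_mix => //; first exact: measurable_funeneg.
  exact: integral_funeneg_lt_pinfty.
have kintE s : (k s).-integrable [set: T] f = (A s \is a fin_num).
  rewrite ge0_fin_numE ?integral_ge0//.
  by apply/integrableP/idP => [[]|].
have NE : N = ~` ([set: S] `&` [set s | A s \is a fin_num]).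
  by rewrite setTI; apply/seteqP; split=> s; rewrite /N /= kintE.
have mN : measurable N.
  by rewrite NE; apply: measurableC; exact: emeasurable_fin_num.
have nuN : nu N = 0.
  apply/negligibleP => //; apply: negligibleS (integrable_ae measurableT intA).
  by rewrite NE setTI => s /= nAs /(_ Logic.I).
have IfE : If = (fun s => if A s \is a fin_num then P s - M s else 0).
  by apply/funext => s; rewrite /If kintE integralE.
have mPM : measurable_fun [set: S] (P \- M).
  apply: emeasurable_funB; first exact: measurable_int intP.
  exact: measurable_int intM.
have mIf : measurable_fun [set: S] If.
  rewrite IfE; apply: measurable_fun_ifT => //.
  apply: (measurable_fun_bool true); rewrite setTI.
  by have := emeasurable_fin_num measurableT mA; rewrite setTI.
split => //.
- apply: le_integrable intA => // s _; rewrite /If.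
  case: ifPn => [_|_]; last by rewrite abse0.
  by rewrite [leRHS]gee0_abs ?integral_ge0//; exact: le_abse_integral.
- rewrite integralE ge0_integral_mixture//; last exact: measurable_funepos.
  rewrite [X in _ - X]ge0_integral_mixture//; last exact: measurable_funeneg.
  rewrite -integralB//; apply: ae_eq_integral => //.
  exists N; split => // s /= /not_implyP[_ sPM].
  by rewrite /N /= kintE => As; apply: sPM; rewrite IfE As.
Qed.

End mixture.

(** * Integration along the ergodic decomposition *)

Theorem theorem4p5 (R : realType) (G : topologicalGroupType)
    (X : ptopologicalType) (act : G -> X -> X)
    (mu : probability (borel X) R) (b : X -> ergodic R act)
    (nu := pushforward mu (b : borel X -> borel_ergodic b)) :
  polish_system R act ->
  locally_compact [set: G] ->
  invariant_measure act mu ->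
  decomposition_map b ->
  (forall f : borel X -> \bar R,
     measurable_fun [set: borel X] f -> (forall x, 0 <= f x) ->
     measurable_fun [set: borel_ergodic b]
       (fun l : borel_ergodic b => \int[emeas l]_(x in [set: borel X]) f x) /\
     \int[mu]_(x in [set: borel X]) f x =
       \int[nu]_(l in [set: borel_ergodic b])
         \int[emeas l]_(x in [set: borel X]) f x) /\
  (forall f : borel X -> \bar R,
     mu.-integrable [set: borel X] f ->
     let N : set (borel_ergodic b) :=
       [set l | ~ (emeas l).-integrable [set: borel X] f] in
     let If : borel_ergodic b -> \bar R := integral_or_zero f in
     [/\ measurable N, nu N = 0, nu.-integrable [set: borel_ergodic b] If &
       \int[mu]_(x in [set: borel X]) f x =
         \int[nu]_(l in [set: borel_ergodic b]) If l]).
Proof.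
move=> [_ [_ cmX] _ _ _] _ invmu [mb _ _ disint].
(* the pushforward of [mu] by [b] is a probability once [b] is packed as a
   measurable function *)
pose B : {mfun borel X >-> borel_ergodic b} :=
  HB.pack (b : borel X -> borel_ergodic b) (isMeasurableFun.Build _ _ _ _ _ mb).
pose pnu : probability (borel_ergodic b) R := distribution mu B.
have mev (Y : set (borel X)) : measurable Y ->
    measurable_fun [set: borel_ergodic b] (fun l : borel_ergodic b => emeas l Y).
  exact: measurable_emeas.
have mixE (Y : set (borel X)) : measurable Y ->
    mu Y = \int[pnu]_(l in [set: borel_ergodic b]) emeas l Y.
  move=> mY; rewrite disint// ge0_integral_pushforward//.
  exact: mev.
split=> [f mf f0|f intf].
  split; first exact: measurable_fun_integral_kernel.
  exact: (ge0_integral_mixture mev mixE).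
exact: (integral_mixture mev mixE intf).
Qed.
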